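(* Let $X$ be a reflexive Banach space and let $Z$ be a Hausdorff, locally convex topological vector space, let $C\subseteq Z$ be a convex, pointed cone, and let $K$ be a nonempty, convex and closed subset of $X$. Let $D\subseteq K$ be a self segment-dense set in $K$ in the weak topology of $X$, and consider a mapping $f:K\times K\to Z$ satisfying (i) for all $y\in D$, the mapping $x\mapsto f(x,y)$ is strongly $C$-upper semicontinuous on $K$ in the weak topology of $X$; (ii) for all $x\in K$, the mapping $y\mapsto f(x,y)$ is strongly $C$-upper semicontinuous on $K\setminus D$ in the weak topology of $X$; (iii) for all $x\in K$, the mapping $y\mapsto f(x,y)$ is $C$-convex on $K$; (iv) for all $x\in K$, $f(x,x)=0$; (v) there exists $r>0$ such that for all $x\in K$ with $\|x\|>r$ there exists $y_0\in K$ with $\|y_0\|<\|x\|$ such that $f(x,y_0)\in -C$. Then there exists $x_0\in K$ such that $f(x_0,y)\notin -C\setminus\{0\}$ for all $y\in K$.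
   Context: All vector spaces are real. $\operatorname{cl}$ denotes closure. $-C\setminus\{0\}$ denotes $(-C)\setminus\{0\}=-(C\setminus\{0\})$. The interior of $C$ is allowed to be empty. A set $C\subseteq Z$ is a cone if $tc\in C$ for all $c\in C$ and $t\ge 0$; it is convex if $C+C=C$, and pointed if $C\cap(-C)=\{0\}$. Write $z_1\le z_2$ iff $z_2-z_1\in C$. Strong $C$-upper semicontinuity: a map $g:K\to Z$ is strongly $C$-upper semicontinuous at $x\in K$ if for any $k\in C\setminus\{0\}$ there exists a neighborhood $U$ of $x$ such that $g(u)\in g(x)+k-(C\setminus\{0\})$ for all $u\in U\cap K$. It is strongly $C$-upper semicontinuous on a subset $S\subseteq K$ if it is so, as a map on $K$, at every point of $S$. ''In the weak topology of $X$'' means that the neighborhoods $U$ are taken in the weak topology of $X$. $C$-convexity: for a set $S$, $g$ is $C$-convex on $S$ if for all $n\in\mathbb N$, $x_1,\dots,x_n\in S$ and $\lambda_1,\dots,\lambda_n\ge 0$ with $\sum_{i=1}^n\lambda_i=1$ such that $\sum_{i=1}^n\lambda_i x_i\in S$, one has $g\left(\sum_{i=1}^n\lambda_i x_i\right)\le\sum_{i=1}^n\lambda_i g(x_i)$. Self segment-dense set: let $U\subseteq V\subseteq X$ with $V$ convex. $U$ is self segment-dense in $V$ if $U$ is dense in $V$ (i.e. $V\subseteq\operatorname{cl}U$) and for all $x,y\in U$ the set $[x,y]\cap U$ is dense in $[x,y]$, where $[x,y]=\{x+t(y-x):t\in[0,1]\}$. ''In the weak topology'' means that closures are taken in the weak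 topology of $X$. *)

(* Defs.v *)
From HB Require Import structures.
From mathcomp Require Import all_boot all_order all_algebra.
From mathcomp Require Import all_classical all_reals all_analysis.

Set Implicit Arguments.
Unset Strict Implicit.
Unset Printing Implicit Defensive.

Import Order.TTheory GRing.Theory Num.Theory.
Import numFieldNormedType.Exports.

Local Open Scope classical_set_scope.
Local Open Scope ring_scope.

Section dual.
Context {R : realType}.

Section dual_type.
Variable V : normedModType R.

Definition is_dual : {pred V -> R^o} :=
  fun f => `[< linear f /\ continuous f >].

Record dual := Dual { dual_fun :> V -> R^o; dual_funP : dual_fun \in is_dual }.

HB.instance Definition _ := [isSub for dual_fun].
HB.instance Definition _ := [Choice of dual by <:].

Lemma is_dual_submod_closed : submod_closed is_dual.
Proof.
split; first by apply/asboolP; split;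
  [move=> a x y; rewrite /GRing.zero/= addr0 scaler0 | exact: cst_continuous].
move=> a f g /asboolP[lf cf] /asboolP[lg cg]; apply/asboolP; split.
  move=> b x y.
  change (a *: f (b *: x + y) + g (b *: x + y) =
          b *: (a *: f x + g x) + (a *: f y + g y)).
  rewrite lf lg !scalerDr !scalerA [b * a]mulrC -!addrA; congr (_ + _).
  by rewrite addrCA.
move=> x; apply: cvgD; last exact: cg.
by apply: cvgZl_tmp; exact: cf.
Qed.

HB.instance Definition _ := GRing.isSubmodClosed.Build _ _ is_dual
  is_dual_submod_closed.
HB.instance Definition _ := [SubChoice_isSubLmodule of dual by <:].

Lemma dual_linear (f : dual) : linear f.
Proof. by have /asboolP[] := dual_funP f. Qed.

Lemma dual_continuous (f : dual) : continuous (f : V -> R^o).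
Proof. by have /asboolP[] := dual_funP f. Qed.

HB.instance Definition _ (f : dual) :=
  GRing.isLinear.Build R V R^o _ (dual_fun f) (dual_linear f).

Definition dual_norm (f : dual) : R :=
  sup [set `|f x| | x in [set x : V | `|x| <= 1]].

Lemma dual_norm_has_sup (f : dual) :
  has_sup [set `|f x| | x in [set x : V | `|x| <= 1]].
Proof.
split; first by exists `|f 0|, 0 => //=; rewrite normr0.
have /linear_bounded_continuous/bounded_funP/(_ 1)[M Mf] := @dual_continuous f.
by exists M => _ [x x1 <-]; exact: Mf.
Qed.

Lemma le_dual_norm (f : dual) x : `|f x| <= dual_norm f * `|x|.
Proof.
have [->|x0] := eqVneq x 0; first by rewrite linear0 !normr0 mulr0.
have nx0 : 0 < `|x| by rewrite normr_gt0.
rewrite -ler_pdivrMr// mulrC.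
rewrite -[X in X * _]ger0_norm ?invr_ge0// -normrZ -linearZ.
apply: sup_upper_bound; first exact: dual_norm_has_sup.
exists (`|x|^-1 *: x) => //=.
by rewrite normrZ ger0_norm ?invr_ge0// mulVf// gt_eqF.
Qed.

Lemma dual_norm_le (f : dual) M :
  (forall x, `|x| <= 1 -> `|f x| <= M) -> dual_norm f <= M.
Proof.
move=> fM; apply: ge_sup; first by case: (dual_norm_has_sup f).
by move=> _ [x x1 <-]; exact: fM.
Qed.

Lemma dual_norm_ge0 (f : dual) : 0 <= dual_norm f.
Proof.
apply: (@le_trans _ _ `|f 0|) => //; apply: sup_upper_bound.
  exact: dual_norm_has_sup.
by exists 0 => //=; rewrite normr0.
Qed.

Lemma ler_dual_normD (f g : dual) :
  dual_norm (f + g) <= dual_norm f + dual_norm g.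
Proof.
apply: dual_norm_le => x x1.
apply: (le_trans (ler_normD (f x) (g x))); apply: lerD.
  by apply: (le_trans (le_dual_norm f x)); rewrite ler_piMr// dual_norm_ge0.
by apply: (le_trans (le_dual_norm g x)); rewrite ler_piMr// dual_norm_ge0.
Qed.

Let dual_normZ_le (l : R) (f : dual) : dual_norm (l *: f) <= `|l| * dual_norm f.
Proof.
apply: dual_norm_le => x x1.
change (`|l * f x| <= `|l| * dual_norm f).
rewrite normrM; apply: ler_wpM2l => //.
by apply: (le_trans (le_dual_norm f x)); rewrite ler_piMr// dual_norm_ge0.
Qed.

Lemma dual_normZ (l : R) (f : dual) : dual_norm (l *: f) = `|l| * dual_norm f.
Proof.
apply/eqP; rewrite eq_le dual_normZ_le/=.
have [->|l0] := eqVneq l 0; first by rewrite normr0 mul0r dual_norm_ge0.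
rewrite -ler_pdivlMl ?normr_gt0// -normfV.
by rewrite -{1}[f]scale1r -(mulVf l0) -scalerA dual_normZ_le.
Qed.

Lemma dual_norm_eq0 (f : dual) : dual_norm f = 0 -> f = 0.
Proof.
move=> f0; apply/val_inj/funext => x; apply/eqP; rewrite -normr_le0.
by apply: (le_trans (le_dual_norm f x)); rewrite f0 mul0r.
Qed.

HB.instance Definition _ :=
  Lmodule_isNormed.Build R dual ler_dual_normD dual_normZ dual_norm_eq0.

End dual_type.

(** The canonical embedding [V -> V**], [x |-> (f |-> f x)], is onto. *)
Definition reflexive_space (V : normedModType R) :=
  forall phi : dual (dual V), exists x : V, forall f : dual V, phi f = f x.

Definition weak_topology (V : normedModType R) : Type :=
  sup_topology (fun f : dual V => Topological.on (initial_topology f)).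

HB.instance Definition _ (V : normedModType R) :=
  Topological.on (weak_topology V).
HB.instance Definition _ (V : normedModType R) :=
  GRing.Lmodule.copy (weak_topology V) V.

End dual.

Section cone.
Context {R : realType} {Z : lmodType R}.
Implicit Types C : set Z.

Definition is_cone C := forall (t : R) c, C c -> 0 <= t -> C (t *: c).

Definition convex_cone C :=
  is_cone C /\ [set c1 + c2 | c1 in C & c2 in C] = C.

Definition pointed_cone C := C `&` [set - c | c in C] = [set 0].

Definition cone_le C (z1 z2 : Z) := C (z2 - z1).

End cone.

(** A map defined on a subset [K] of [E] is represented by a total function on
    [E]; only its values on [K] are constrained.  For the weak topology of [X],
    take [E := weak_topology X]. *)

Section vector_valued.
Context {R : realType} {Z : lmodType R}.

Definition strongly_usc_at {E : topologicalType} (C : set Z) (K : set E)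
    (g : E -> Z) (x : E) :=
  forall k, (C `\ 0) k -> exists2 U, nbhs x U &
    forall u, (U `&` K) u -> [set g x + k - c | c in C `\ 0] (g u).

Definition strongly_usc_on {E : topologicalType} (C : set Z) (K S : set E)
    (g : E -> Z) :=
  forall x, S x -> strongly_usc_at C K g x.

(** [n = 0] is harmless: the weights would sum to [0]. *)
Definition cone_convex_on {E : lmodType R} (C : set Z) (S : set E)
    (g : E -> Z) :=
  forall (n : nat) (x : 'I_n -> E) (lambda : 'I_n -> R),
    (forall i, S (x i)) -> (forall i, 0 <= lambda i) ->
    \sum_(i < n) lambda i = 1 ->
    S (\sum_(i < n) lambda i *: x i) ->
    cone_le C (g (\sum_(i < n) lambda i *: x i))
              (\sum_(i < n) lambda i *: g (x i)).

End vector_valued.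

Section self_segment_dense.
Context {R : realType}.

Definition segment {E : lmodType R} (x y : E) : set E :=
  [set x + t *: (y - x) | t in `[0 : R, 1]].

(** Convexity of [V] and [U `<=` V] are assumed separately. *)
Definition self_segment_dense {E : preTopologicalLmodType R} (U V : set E) :=
  V `<=` closure U /\
  forall x y, U x -> U y -> segment x y `<=` closure (segment x y `&` U).

End self_segment_dense.

(* Main.v *)
Require Import Defs.
From HB Require Import structures.
From mathcomp Require Import all_boot all_order all_algebra.
From mathcomp Require Import all_classical all_reals all_analysis.
From mathcomp Require Import finmap ring lra.

(**
  Negativity of [f(., y)] is weakly open on [K] for [y] in [D], and convexity
  together with [f(x, x) = 0] makes the sets [{x | f(x, y) is not in -C \ 0}],
  [y] in [D], a KKM family.  Fix [M > r] with [K] meeting the open [M]-ball.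
  The part of [K] in the closed [M]-ball is weakly compact, so some [x0] lies in
  all these sets with [y] in [D] and [|y| <= M].  The norm closure of [D] is
  convex, hence weakly closed by Mazur, so [D] is norm dense in [K]; upper
  semicontinuity in [y] then extends the conclusion to all [y] in [K] with
  [|y| < M].  Coercivity provides [y0] in the open ball with [f(x0, y0) = 0],
  and a negative value [f(x0, y)] at a remote [y] would by convexity propagate
  along the segment from [y] to [y0] into the open ball.

  The KKM lemma rests on Scarf's combinatorial lemma, with the parity argument
  of N. Ivanov ("Beyond Sperner's lemma"): only linear orders on a finite set of
  grid points are needed, no triangulation.
*)

Set Implicit Arguments.
Unset Strict Implicit.
Unset Printing Implicit Defensive.

Import Order.TTheory GRing.Theory Num.Theory.
Import numFieldNormedType.Exports.

(** * Scarf's lemma *)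

Section Scarf.
Import boot.fintype boot.finset.

Lemma imset_setD1_twin (aT rT : finType) (f : aT -> rT) (A : {set aT}) x y :
  x != y -> y \in A -> f x = f y -> f @: (A :\ x) = f @: A.
Proof.
move=> xy yA fxy; apply/eqP; rewrite eqEsubset imsetS ?subD1set//=.
apply/subsetP => _ /imsetP[z zA ->]; have [->|zx] := eqVneq z x.
  by rewrite fxy imset_f// !inE eq_sym xy.
by rewrite imset_f// !inE zx.
Qed.

Variables (T I : finType) (r : I -> T -> nat).
Hypothesis r_inj : forall i, injective (r i).

(* The order number [i] is given by the injective ranks [r i]: no [y] lies above
   the minimum of [s] for all the orders in [C] at once. *)
Definition dominant (s : {set T}) (C : {set I}) :=
  [forall y, exists i in C, forall x in s, r i y <= r i x].

Lemma dominantP (s : {set T}) (C : {set I}) :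
  reflect (forall y, exists2 i, i \in C & forall x, x \in s -> r i y <= r i x)
          (dominant s C).
Proof.
apply: (iffP forallP) => H y.
  have /existsP[i /andP[iC /forallP h]] := H y.
  by exists i => // x xs; have /implyP := h x; apply.
have [i iC h] := H y; apply/existsP; exists i; rewrite iC /=.
by apply/forallP => x; apply/implyP; exact: h.
Qed.

Lemma dominantS (s s' : {set T}) (C C' : {set I}) :
  s \subset s' -> C' \subset C -> dominant s' C' -> dominant s C.
Proof.
move=> /subsetP ss /subsetP CC /dominantP dom; apply/dominantP => y.
by have [i iC h] := dom y; exists i; [exact: CC | move=> x /ss; exact: h].
Qed.

Lemma dominant0 i : dominant set0 [set i].
Proof.
by apply/dominantP => y; exists i; rewrite ?set11// => x; rewrite inE.
Qed.

(** Rooms stand for full-dimensional simplices and doors for their facets: a door arises from a room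
    by removing one point or adding one order. *)
Definition room (q : {set T} * {set I}) := (#|q.1| == #|q.2|) && dominant q.1 q.2.

Definition door (q : {set T} * {set I}) :=
  (#|q.1|.+1 == #|q.2|) && dominant q.1 q.2.

Definition door_of (d q : {set T} * {set I}) :=
  (d.1 \subset q.1) && (q.2 \subset d.2).

(** The gaps [#|s| - #|t|] and [#|D| - #|C|] add up to one, so exactly one of the two inclusions is
    strict, by a single element. *)
Lemma door_ofP d q : door d -> room q -> door_of d q ->
  (exists2 x, x \notin d.1 & q = (x |: d.1, d.2)) \/
  (exists2 i, i \in d.2 & q = (d.1, d.2 :\ i)).
Proof.
case: d q => [t D] [s C] /andP[/= /eqP cd _] /andP[/= /eqP cs _] /andP[/= ts CD].
have := subset_leq_card ts; rewrite leq_eqVlt => /orP[/eqP cts|cts].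
  right; have /eqP est : t == s by rewrite eqEcard ts cts leqnn.
  have : #|D :\: C| == 1.
    by rewrite cardsD (setIidPr CD) -cd -cs -est subSnn.
  move=> /cards1P[i Di]; exists i.
    by have /setDP[] : i \in D :\: C by rewrite Di set11.
  by rewrite est -Di setDDr setDv set0U (setIidPr CD).
left.
have cDs : #|s| = #|t|.+1.
  by apply/eqP; rewrite eqn_leq cts andbT cs cd subset_leq_card.
have /eqP eCD : C == D by rewrite eqEcard CD -cd -cDs cs leqnn.
have : #|s :\: t| == 1 by rewrite cardsD (setIidPr ts) cDs subSnn.
move=> /cards1P[x sx]; exists x.
  by have /setDP[] : x \in s :\: t by rewrite sx set11.
by rewrite -sx eCD setUC setDE setUIr setUCr setIT (setUidPr ts).
Qed.

Lemma door_of_add x (t : {set T}) (D : {set I}) : door_of (t, D) (x |: t, D).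
Proof. by rewrite /door_of /= subsetUr subxx. Qed.

Lemma door_of_rem i (t : {set T}) (D : {set I}) : door_of (t, D) (t, D :\ i).
Proof. by rewrite /door_of /= subD1set subxx. Qed.

(** * The rooms of a door with at least one point *)

Section InternalDoor.
Variables (t : {set T}) (D : {set I}) (x0 : T).
Hypotheses (tD : door (t, D)) (x0t : x0 \in t).

Let m i := [arg min_(x < x0 in t) r i x].

Let m_in i : m i \in t.
Proof. by rewrite /m; case: arg_minnP. Qed.

Let m_le i x : x \in t -> r i (m i) <= r i x.
Proof. by rewrite /m; case: arg_minnP => // y _ h /h. Qed.

Let m_eq i x : x \in t -> (forall y, y \in t -> r i x <= r i y) -> x = m i.
Proof.
by move=> xt h; apply: (r_inj (i := i)); apply/eqP; rewrite eqn_leq h// m_le.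
Qed.

Let dom : dominant t D. Proof. by case/andP: tD. Qed.

Let cardD : #|D| = #|t|.+1. Proof. by case/andP: tD => /eqP. Qed.

(** Dominance tested at a point [x] of [t] itself yields an order of [C] with minimum [x]. *)
Let m_onto (C : {set I}) : dominant t C -> m @: C = t.
Proof.
move=> /dominantP domC; apply/eqP; rewrite eqEsubset; apply/andP; split.
  by apply/subsetP => _ /imsetP[i _ ->].
apply/subsetP => x xt; have [i iC hi] := domC x.
by apply/imsetP; exists i => //; exact: m_eq.
Qed.

Let m_twins : exists i j, [/\ i != j, i \in D, j \in D & m i = m j].
Proof.
have [/dinjectiveP minj|] := boolP (dinjectiveb m D).
  have /imset_injP : {in D &, injective m} := minj.
  by rewrite m_onto// cardD ltn_eqF.
by move=> /dinjectivePn[i iD [j]]; rewrite !inE => /andP[ji jD] e; exists j, i.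
Qed.

(** The orders whose removal leaves [m] a bijection onto [t]; they turn out to be the two twins. *)
Let splits k := (k \in D) && (m @: (D :\ k) == t).

Let split_inj k : splits k -> {in D :\ k &, injective m}.
Proof.
move=> /andP[kD /eqP tk]; apply/imset_injP.
by rewrite tk; have := cardD; rewrite (cardsD1 k) kD add1n => -[->].
Qed.

Let twins_split i j : i != j -> i \in D -> j \in D -> m i = m j -> splits i.
Proof.
by move=> ij iD jD mij; rewrite /splits iD (imset_setD1_twin ij)//= m_onto.
Qed.

Let split_twins i j k : i != j -> i \in D -> j \in D -> m i = m j ->
  splits k -> k = i \/ k = j.
Proof.
move=> ij iD jD mij sk.
have [|ki] := eqVneq k i; [by left|]; have [|kj] := eqVneq k j; [by right|].
by case/eqP: ij; apply: (split_inj sk); rewrite // !inE ?iD ?jD eq_sym ?ki ?kj.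
Qed.

(* The orders of [D] have exactly two twins [i], [j] with the same minimum in
   [t].  The two rooms of the door [(t, D)] are obtained, for each twin [k], by
   adding to [t] the [k]-largest point above all the other minima or, if
   there is none, by dropping the order [k]. *)
Let upper k := [set y | [forall l in D :\ k, r l (m l) < r l y]].

Let upperP k y : reflect (forall l, l \in D -> l != k -> r l (m l) < r l y)
  (y \in upper k).
Proof.
rewrite inE; apply: (iffP forallP) => h l.
  by move=> lD lk; have /implyP := h l; rewrite !inE lD lk; apply.
by apply/implyP; rewrite !inE => /andP[lk lD]; exact: h.
Qed.

Let other k := if [pick y in upper k] is Some y
  then ([arg max_(z > y in upper k) r k z] |: t, D) else (t, D :\ k).

Let otherP k (P : {set T} * {set I} -> Prop) :
  (upper k = set0 -> P (t, D :\ k)) ->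
  (forall x, x \in upper k -> (forall y, y \in upper k -> r k y <= r k x) ->
    P (x |: t, D)) -> P (other k).
Proof.
move=> h0 h1; rewrite /other; case: pickP => [y yu|u0].
  by case: arg_maxnP => // x xu xm; exact: h1.
by apply: h0; apply/setP => y; rewrite u0 inE.
Qed.

Let upper_notin k x : splits k -> x \in upper k -> x \notin t.
Proof.
move=> /andP[kD /eqP tk] /upperP xu; apply/negP => xt.
have : x \in m @: (D :\ k) by rewrite tk.
case/imsetP=> l; rewrite !inE => /andP[lk lD] e.
by have := xu l lD lk; rewrite {1}e ltnn.
Qed.

(** Dominance puts [x] below the minimum in some order of [D], and membership in [upper k] excludes
    every order but [k]. *)
Let upper_lt k x : splits k -> x \in upper k -> r k x < r k (m k).
Proof.
move=> sk xu; have /dominantP/(_ x)[l lD hl] := dom.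
have [lk|lk] := eqVneq l k; last first.
  by have /upperP/(_ l lD lk) := xu; rewrite ltnNge hl// m_in.
subst l; rewrite ltn_neqAle hl ?m_in// andbT.
apply/eqP => /r_inj xm; have := upper_notin sk xu.
by rewrite xm m_in.
Qed.

(** A [y] outside [upper k] is below the minimum in some order other than [k], and an added point
    does not lower that minimum. A [y] in [upper k] is handled by [k], whose minimum becomes the
    added point. *)
Let other_room k : splits k -> room (other k).
Proof.
move=> sk; have /andP[kD /eqP tk] := sk.
apply: (@otherP k room) => [u0|x xu xm]; rewrite /room /=.
  rewrite -(eqn_add2l (k \in D)) -cardsD1 cardD kD eqxx/=.
  apply/dominantP => y.
  have /existsP[l] : [exists l, [&& l \in D, l != k & r l y <= r l (m l)]].
    apply: contra_eqT u0 => /existsPn h; apply/set0Pn; exists y; apply/upperP.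
    by move=> l lD lk; have := h l; rewrite lD lk /= -ltnNge.
  move=> /and3P[lD lk le]; exists l; first by rewrite !inE lk.
  by move=> z zt; exact: leq_trans (m_le l zt).
rewrite cardsU1 (upper_notin sk xu) cardD eqxx/=.
apply/dominantP => y.
have [yu|/upperP yu] := boolP (y \in upper k).
  exists k => // z /setU1P[->|zt]; first exact: xm.
  by apply: leq_trans (m_le k zt); apply: ltnW; exact: upper_lt.
have /existsP[l] : [exists l, [&& l \in D, l != k & r l y <= r l (m l)]].
  apply: contra_notT yu => /existsPn h l lD lk.
  by have := h l; rewrite lD lk /= -ltnNge.
move=> /and3P[lD lk le]; exists l => // z /setU1P[->|zt].
  by have /upperP/(_ l lD lk)/ltnW := xu; exact: leq_trans.
exact: leq_trans (m_le l zt).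
Qed.

Let other_door k : door_of (t, D) (other k).
Proof.
apply: (@otherP k (door_of (t, D))) => [_|x _ _]; first exact: door_of_rem.
exact: door_of_add.
Qed.

(** If [q] drops [k], its dominance leaves no point in [upper k]. If [q] adds [x], dominance at [x]
    makes [x] the minimum of some order [k]; the other orders keep the points of [t] as minima, and
    dominance at the largest point of [upper k] identifies it with [x]. *)
Let other_all q : room q -> door_of (t, D) q -> exists2 k, splits k & q = other k.
Proof.
move=> rq dq; have := door_ofP tD rq dq => -[/= [x xt qE]|/= [k kD qE]]; last first.
  have domk : dominant t (D :\ k) by move: rq; rewrite qE => /andP[].
  have sk : splits k by rewrite /splits kD m_onto/=.
  exists k => //; apply: (@otherP k (eq q)) => // x xu xm.
  have /dominantP/(_ x)[l] := domk; rewrite !inE => /andP[lk lD] /(_ (m l)).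
  by have /upperP/(_ l lD lk) := xu; rewrite ltnNge m_in => /negP h /(_ isT).
have domx : dominant (x |: t) D by move: rq; rewrite qE => /andP[].
have [k kD kx] := dominantP _ _ domx x.
have domt z : z \in t ->
    exists l, [/\ l \in D :\ k, z = m l & r l z < r l x].
  move=> zt; have [l lD lz] := dominantP _ _ domx z.
  have zx : r l z < r l x.
    rewrite ltn_neqAle lz ?setU11// andbT.
    by apply: contraNneq xt => /r_inj <-.
  exists l; split => //; last by apply: m_eq => // y yt; rewrite lz// setU1r.
  rewrite !inE lD andbT; apply: contraTneq zx => ->.
  by rewrite -leqNgt kx// setU1r.
have sk : splits k.
  rewrite /splits kD eqEsubset/=; apply/andP; split.
    by apply/subsetP => _ /imsetP[i _ ->].
  by apply/subsetP => z /domt[l [lD -> _]]; exact: imset_f.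
have xu : x \in upper k.
  apply/upperP => l lD lk; have [l' [l'D e lt]] := domt _ (m_in l).
  by rewrite (split_inj sk (x := l) (y := l')) -?e// !inE lk.
exists k => //; apply: (@otherP k (eq q)) => [u0|x' x'u x'm].
  by move: xu; rewrite u0 inE.
rewrite qE; congr (_ |: _, _); apply: (r_inj (i := k)); apply/eqP.
rewrite eqn_leq x'm //=.
have [l lD lx'] := dominantP _ _ domx x'.
have [<-|lk] := eqVneq l k; first by rewrite lx' // setU11.
by have /upperP/(_ l lD lk) := x'u; rewrite ltnNge lx'// setU1r// m_in.
Qed.

Let other_neq i j : i != j -> i \in D -> j \in D -> splits i -> splits j ->
  other i != other j.
Proof.
move=> ij iD jD si sj.
have nD k : k \in D -> D != D :\ k.
  by move=> kD; apply/eqP => /setP/(_ k); rewrite kD !inE eqxx.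
apply: (@otherP i (fun q => q != other j)) => [_|x xu _];
  apply: (@otherP j (fun q => _ != q)) => [_|y yu _]; apply/eqP => -[].
- by move=> /setP/(_ i); rewrite !inE eqxx iD ij.
- by move=> _ /esym/eqP; apply/negP/nD.
- by move=> _ /eqP; apply/negP/nD.
- move=> /setP/(_ x); rewrite setU11 => /esym/setU1P[xy|]; last first.
    by apply/negP; exact: upper_notin xu.
  (* Every order of [D] differs from [i] or from [j], so a point added for both twins would lie
     above all the minima, against dominance. *)
  subst y; have /dominantP/(_ x)[l lD hl] := dom.
  have := hl _ (m_in l); rewrite leqNgt => /negP[].
  have [->|li] := eqVneq l i; first by move/upperP : yu; exact.
  by move/upperP : xu; exact.
Qed.

Lemma card_door_rooms : #|[set q | room q && door_of (t, D) q]| = 2.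
Proof.
have [i [j [ij iD jD mij]]] := m_twins.
have si := twins_split ij iD jD mij.
have sj : splits j by apply: twins_split (esym mij); rewrite // eq_sym.
suff -> : [set q | room q && door_of (t, D) q] = [set other i; other j].
  by rewrite cards2 other_neq.
apply/setP => q; rewrite !inE; apply/andP/orP => [[rq dq]|].
  have [k sk ->] := other_all rq dq.
  by have [->|->] := split_twins ij iD jD mij sk; [left|right].
by case=> /eqP ->; split; rewrite ?other_door ?other_room.
Qed.

End InternalDoor.

(** A room [([set z], [set i])] is dominant only for the largest [z] in the order [i], and dropping
    [i] leaves no order to dominate with. *)
Lemma card_outer_door_rooms i : (0 < #|T|) ->
  #|[set q | room q && door_of (set0, [set i]) q]| = 1.
Proof.
move=> /card_gt0P[y0 _]; apply/eqP/cards1P.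
pose x := [arg max_(x > y0) r i x].
have xm y : r i y <= r i x by rewrite /x; case: arg_maxnP => // z _; apply.
exists ([set x], [set i]); apply/setP => q; rewrite !inE.
apply/andP/eqP => [[rq dq]|->]; last first.
  split; last by rewrite /door_of /= sub0set subxx.
  rewrite /room /= !cards1 eqxx; apply/dominantP => y.
  by exists i; rewrite ?set11// => z /set1P ->.
have d0 : door (set0, [set i]) by rewrite /door /= cards0 cards1 eqxx dominant0.
have := door_ofP d0 rq dq => -[/= [z _ qE]|/= [k /set1P -> qE]].
  move: rq; rewrite qE setU0 => /andP[_ /= /dominantP/(_ x)[j /set1P ->]].
  move=> /(_ z (set11 z)) le; congr ([set _], _).
  by apply: (r_inj (i := i)); apply/eqP; rewrite eqn_leq xm.
move: rq; rewrite qE setDv => /andP[_ /= /dominantP/(_ x)[j]].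
by rewrite inE.
Qed.

(** * The parity argument for colored points *)

Section Coloring.
Variables (c : T -> I) (i0 : I).

(** The counterpart of the facets with all labels but one in Sperner's lemma. *)
Definition almost_colorful (d : {set T} * {set I}) :=
  [&& door d, i0 \in d.2 & c @: d.1 == d.2 :\ i0].

(** If there is such a door, some [x] in [s] has [c x != i0] and its removal leaves the colors
    [C :\ i0]. If [c x] is in [C], another point [x'] has the same color and the doors drop [x] or
    [x']; otherwise they drop [x] or add the order [c x]. *)
Lemma even_almost_colorful_doors q : room q -> c @: q.1 != q.2 ->
  ~~ odd #|[set d | almost_colorful d && door_of d q]|.
Proof.
case: q => s C rq /= /eqP ncol.
have /andP[/= /eqP cs dom] := rq.
pose S := [set d | almost_colorful d && door_of d (s, C)].
have SP d : d \in S ->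
    (exists2 x, x \in s & [/\ d = (s :\ x, C), i0 \in C & c @: (s :\ x) = C :\ i0]) \/
    (exists2 j, j \notin C & [/\ d = (s, j |: C), i0 \in j |: C
      & c @: s = (j |: C) :\ i0]).
  rewrite inE => /andP[/and3P[dd id /eqP cd] dq].
  have := door_ofP dd rq dq => -[[x xd []]|[j jd []]] e1 e2.
    left; exists x; first by rewrite e1 setU11.
    have -> : s :\ x = d.1 by rewrite e1 setU1K.
    by rewrite e2 -surjective_pairing.
  right; exists j; first by rewrite e2 !inE eqxx.
  have -> : j |: C = d.2 by rewrite e2 setD1K.
  by rewrite e1 -surjective_pairing.
have memA x : x \in s -> i0 \in C -> c @: (s :\ x) = C :\ i0 -> (s :\ x, C) \in S.
  move=> xs iC cx; rewrite inE /almost_colorful /door /door_of /= iC cx eqxx /=.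
  rewrite -cs (cardsD1 x s) xs add1n eqxx subD1set subxx /= !andbT.
  exact: dominantS (subD1set _ _) (subxx _) dom.
have memB j : j \notin C -> i0 \in j |: C -> c @: s = (j |: C) :\ i0 ->
    (s, j |: C) \in S.
  move=> jC ij cj; rewrite inE /almost_colorful /door /door_of /= ij cj eqxx /=.
  rewrite cs cardsU1 jC eqxx subsetUr subxx /= !andbT.
  exact: dominantS (subxx _) (subsetUr _ _) dom.
rewrite -/S; have [->|[d0 d0S]] := set_0Vmem S; first by rewrite cards0.
(* When the given door adds an order [j], the point of color [j] is the one to drop. *)
have [x xs [iC cx]] : exists2 x, x \in s & i0 \in C /\ c @: (s :\ x) = C :\ i0.
  have [[x xs [_ iC cx]]|[j jC [_ ij cj]]] := SP _ d0S; first by exists x.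
  have i0C : i0 \in C.
    move: ij => /setU1P[ij|//]; case: ncol.
    by rewrite cj ij setU1K.
  have i0j : i0 != j by apply: contraNneq jC => <-.
  have : j \in c @: s by rewrite cj !inE eqxx eq_sym i0j.
  move=> /imsetP[x xs jx]; exists x => //; split=> //.
  have cinj : {in s &, injective c}.
    apply/imset_injP; rewrite cj cs; have := cardsD1 i0 (j |: C).
    by rewrite cardsU1 jC ij !add1n => -[->].
  apply/setP => i; rewrite !inE; apply/imsetP/andP.
    move=> [y /setD1P[yx ys] ->].
    have : c y \in c @: s by exact: imset_f.
    rewrite cj !inE => /andP[-> /orP[/eqP cyj|->//]].
    by move: yx; rewrite (cinj y x)// ?eqxx// cyj.
  move=> [ii0 iC]; have : i \in c @: s by rewrite cj !inE ii0 iC orbT.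
  move=> /imsetP[y ys iy]; exists y => //; rewrite !inE ys andbT.
  by apply: contraNneq jC => yx; rewrite jx -yx -iy.
have csx : c @: s = c x |: (C :\ i0) by rewrite -cx -imsetU1 setD1K.
have cxi0 : c x != i0.
  by apply/eqP => cxi0; apply: ncol; rewrite csx cxi0 setD1K.
have [cxC|cxC] := boolP (c x \in C).
  have : c x \in c @: (s :\ x) by rewrite cx !inE cxi0.
  move=> /imsetP[x' /setD1P[x'x x's] cxx'].
  have cx' : c @: (s :\ x') = C :\ i0.
    rewrite (imset_setD1_twin x'x xs (esym cxx')) csx.
    by apply/setUidPr; rewrite sub1set !inE cxi0.
  have SE : S = [set (s :\ x, C); (s :\ x', C)].
    apply/setP => d; apply/idP/set2P => [/SP|[->|->]]; [|exact: memA..].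
    move=> [[y ys [-> _ cy]]|[j jC [_ ij cj]]].
      have [->|yx] := eqVneq y x; [by left|].
      have [->|yx'] := eqVneq y x'; [by right|].
      have cinj : {in s :\ y &, injective c}.
        apply/imset_injP; rewrite cy.
        have := cs; rewrite (cardsD1 y s) ys (cardsD1 i0 C) iC !add1n => -[->].
        by rewrite eqxx.
      by case/eqP: x'x; apply: cinj => //; rewrite !inE 1?eq_sym ?yx' ?yx.
    have : j \in c @: s.
      rewrite cj !inE eqxx /= andbT.
      by apply: contraNneq jC => ->.
    rewrite csx => /setU1P[e|/setD1P[_]]; first by rewrite e cxC in jC.
    by rewrite (negPf jC).
  rewrite SE cards2 (_ : _ != _ = true)//.
  by apply/eqP => -[] /setP/(_ x); rewrite !inE eqxx xs eq_sym x'x.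
have SE : S = [set (s :\ x, C); (s, c x |: C)].
  apply/setP => d; apply/idP/set2P => [/SP|[->|->]].
  - move=> [[y ys [-> _ cy]]|[j jC [-> ij cj]]].
      have [->|yx] := eqVneq y x; [by left|].
      have : c x \in c @: (s :\ y) by apply: imset_f; rewrite !inE eq_sym yx.
      by rewrite cy !inE (negPf cxC) andbF.
    have : c x \in c @: s by apply: imset_f.
    by rewrite cj !inE (negPf cxC) orbF => /andP[_ /eqP ->]; right.
  - exact: memA.
  - apply: memB => //; first by rewrite !inE iC orbT.
    by rewrite csx; apply/setP => i; rewrite !inE; case: eqVneq => // ->; rewrite cxi0.
rewrite SE cards2 (_ : _ != _ = true)//.
by apply/eqP => -[] /setP/(_ x); rewrite !inE eqxx xs.
Qed.

(** Incidences of rooms and almost colorful doors are counted in two ways. Doors with points lie in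
    two rooms and [(set0, [set i0])] in one, so the count is odd; without a colorful room each room
    would contribute an even number. *)
Theorem colorful_room : 0 < #|T| ->
  exists s C, [/\ s != set0, dominant s C & c @: s = C].
Proof.
move=> T0; have [/existsP[[s C]]|nex] :=
  boolP ([exists q, room q && (c @: q.1 == q.2)]).
  move=> /andP[/andP[/= /eqP cs dom] /eqP csC]; exists s, C; split => //.
  apply: contraTneq dom => s0; move/card_gt0P: T0 => [y _].
  apply/dominantP => /(_ y)[i]; rewrite (_ : C = set0) ?inE//.
  by apply/eqP; rewrite -cards_eq0 -cs s0 cards0.
have cardE (U : finType) (P Q : pred U) :
    \sum_(u | P u) Q u = #|[set u | P u && Q u]|.
  rewrite -sum1dep_card big_mkcondr; apply: eq_bigr => u _; by case: (Q u).
have even_sum (U : finType) (P : pred U) (F : U -> nat) :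
    (forall u, P u -> ~~ odd (F u)) -> ~~ odd (\sum_(u | P u) F u).
  move=> h; apply: (big_ind (fun n => ~~ odd n)) => // m n.
  by rewrite oddD => /negPf -> /negPf ->.
have ev : ~~ odd (\sum_(q | room q) \sum_(d | almost_colorful d) door_of d q).
  apply: even_sum => q rq; rewrite cardE.
  apply: even_almost_colorful_doors => //; apply: contra nex => qc.
  by apply/existsP; exists q; rewrite rq.
suff : odd (\sum_(q | room q) \sum_(d | almost_colorful d) door_of d q).
  by rewrite (negPf ev).
rewrite exchange_big (bigD1 (set0, [set i0])) /=; last first.
  rewrite /almost_colorful /door /= cards0 cards1 eqxx dominant0 set11 /=.
  by rewrite imset0 setDv.
rewrite cardE card_outer_door_rooms// oddD /=.
apply: even_sum => -[t D] /andP[/and3P[dd id /eqP cd] ne].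
rewrite cardE; have [t0|[x xt]] := set_0Vmem t; last first.
  by rewrite (card_door_rooms dd xt).
move: dd id ne; rewrite t0 /door /= cards0.
by move=> /andP[/eqP/esym/eqP/cards1P[i ->] _] /set1P ->; rewrite eqxx.
Qed.
End Coloring.
End Scarf.

Local Open Scope classical_set_scope.
Local Open Scope ring_scope.

(** * The KKM lemma *)

Section Grid.
Local Open Scope nat_scope.
Variables (n N : nat).

(** The lattice points of the standard simplex dilated by [N]. *)
Definition grid : Type := {x : {ffun 'I_n -> 'I_N.+1} | \sum_i x i == N}.
HB.instance Definition _ := Finite.on grid.

Definition grid_coord (x : grid) (i : 'I_n) : nat := val x i.

Lemma sum_grid_coord x : \sum_i grid_coord x i = N.
Proof. exact/eqP/(valP x). Qed.

Lemma grid_of (y : 'I_n -> nat) : \sum_i y i = N ->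
  exists x : grid, forall i, grid_coord x i = y i.
Proof.
move=> yN.
have yi i : y i < N.+1 by rewrite ltnS -yN (bigD1 i)//= leq_addr.
have h : \sum_i [ffun i => Ordinal (yi i)] i == N.
  by rewrite -[X in _ == X]yN; apply/eqP/eq_bigr => i _; rewrite ffunE.
by exists (exist _ [ffun i => Ordinal (yi i)] h) => i; rewrite /grid_coord /= ffunE.
Qed.

(** By dominance no grid point exceeds the minima [m] at all coordinates of [C], so these minima add
    up to more than [N - n]. Points of [s] thus stay within [n] of the minima on [C] and below [n]
    off [C]. *)
Lemma grid_room (c : grid -> 'I_n) : 0 < n ->
  exists p : grid, forall i, (exists2 q, c q = i &
    forall j, (grid_coord p j <= grid_coord q j + n) &&
      (grid_coord q j <= grid_coord p j + n)) \/
    grid_coord p i <= n.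
Proof.
move=> n0; pose i0 := Ordinal n0.
(* Compare the coordinate [i] and break ties by the enumeration of the grid. *)
pose r i x := grid_coord x i * #|{: grid}| + enum_rank x.
have rinj i : injective (r i).
  move=> x y /(congr1 (fun k => k %% #|{: grid}|)).
  by rewrite /r !modnMDl !modn_small ?ltn_ord// => /val_inj/enum_rank_inj.
have rlt i x y : grid_coord x i < grid_coord y i -> r i x < r i y.
  move=> xy; rewrite /r (@leq_trans ((grid_coord x i).+1 * #|{: grid}|))//.
    by rewrite mulSn addnC ltn_add2r ltn_ord.
  by rewrite (leq_trans (leq_mul xy (leqnn _)))// leq_addr.
have T0 : 0 < #|{: grid}|.
  have [|x _] := @grid_of (fun i => (i == i0) * N).
    by rewrite (bigD1 i0)//= mul1n big1 ?addn0// => i /negPf ->.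
  by apply/card_gt0P; exists x.
have [s [C [s0 dom cs]]] := colorful_room rinj c i0 T0.
have [p ps] := set0Pn _ s0.
pose m i := grid_coord [arg min_(x < p in s) grid_coord x i] i.
have m_le i x : x \in s -> m i <= grid_coord x i.
  by rewrite /m; case: arg_minnP => // y _ h /h.
have m_ex i : exists2 x, x \in s & grid_coord x i = m i.
  by rewrite /m; case: arg_minnP => // y ys _; exists y.
have cpC : c p \in C by rewrite -cs imset_f.
have mN : N < \sum_(i in C) (m i).+1.
  rewrite ltnNge; apply/negP => le.
  (* A grid point above all the minima: one more than [m i] on [C], with the rest of [N] placed at
     [c p], which lies in [C]. *)
  pose y i := (i \in C) * (m i).+1 + (i == c p) * (N - \sum_(i in C) (m i).+1).
  have [|x xy] := @grid_of y.
    rewrite big_split /= -[RHS](subnKC le); congr (_ + _).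
      by rewrite [RHS]big_mkcond; apply: eq_bigr => i _; case: ifP; rewrite ?mul1n.
    by rewrite (bigD1 (c p))//= eqxx mul1n [X in _ + X]big1 ?addn0// => i /negPf ->.
  have [i iC hi] := dominantP _ _ _ dom x.
  have [z zs zm] := m_ex i; have := hi _ zs; rewrite leqNgt => /negP[].
  by apply: rlt; rewrite zm xy /y iC mul1n leq_addr.
have sumC : \sum_(i in C) (m i).+1 <= \sum_(i in C) m i + n.
  under eq_bigr do rewrite -addn1.
  rewrite big_split/= leq_add2l sum1_card.
  by rewrite -[X in _ <= X]card_ord max_card.
have lt_in x j : x \in s -> j \in C -> grid_coord x j < m j + n.
  move=> xs jC; rewrite -(ltn_add2r (\sum_(i in C | i != j) m i)) addnAC.
  rewrite -(bigD1 j)//=; apply: leq_trans sumC; apply: leq_ltn_trans mN.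
  rewrite -[X in _ <= X](sum_grid_coord x) [X in _ <= X](bigD1 j)//= leq_add2l.
  rewrite big_mkcond [X in _ <= X]big_mkcond/=; apply: leq_sum => i _.
  by case: (i \in C) => //=; case: ifP => // _; exact: m_le.
have lt_out x j : x \in s -> j \notin C -> grid_coord x j < n.
  move=> xs jC; rewrite -(ltn_add2r (\sum_(i in C) m i)) [X in _ < X]addnC.
  apply: leq_trans sumC; apply: leq_ltn_trans mN.
  rewrite -[X in _ <= X](sum_grid_coord x) [X in _ <= X](bigD1 j)//= leq_add2l.
  rewrite big_mkcond [X in _ <= X]big_mkcond/=; apply: leq_sum => i _.
  case: ifPn => [iC|_]; last by case: ifP.
  by case: eqVneq iC => [->|_ _]; [rewrite (negPf jC)|exact: m_le].
have near x y j : x \in s -> y \in s -> grid_coord x j <= grid_coord y j + n.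
  move=> xs ys; have [jC|jC] := boolP (j \in C).
    by rewrite (leq_trans (ltnW (lt_in _ _ xs jC)))// leq_add2r m_le.
  by rewrite (leq_trans (ltnW (lt_out _ _ xs jC)))// leq_addl.
exists p => i; have [iC|iC] := boolP (i \in C); last first.
  by right; apply/ltnW/lt_out.
left; move: iC; rewrite -cs => /imsetP[q qs ->]; exists q => // j.
by rewrite !near.
Qed.
End Grid.

(** * Distance to a set *)

Section InfDist.
Context {R : realType} {V : normedModType R}.
Implicit Types (A : set V) (x y : V).

(** For empty [A] the value is 0, the default of [inf]; hence the non-emptiness in
    [infdist_closed]. *)
Definition infdist A x : R := inf [set `|x - a| | a in A].

Let lbound0 A x : lbound [set `|x - a| | a in A] 0.
Proof. by move=> _ [a _ <-]. Qed.

Lemma infdist_ge0 A x : 0 <= infdist A x.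
Proof.
have [->|/set0P[a Aa]] := eqVneq A set0; first by rewrite /infdist image_set0 inf0.
by apply: lb_le_inf; [exists `|x - a|, a|exact: lbound0].
Qed.

Lemma infdist_le A x a : A a -> infdist A x <= `|x - a|.
Proof. by move=> Aa; apply: ge_inf; [exists 0; exact: lbound0|exists a]. Qed.

Lemma infdist_eq0 A x : A x -> infdist A x = 0.
Proof.
move=> Ax; apply/eqP; rewrite eq_le infdist_ge0 andbT.
by rewrite (le_trans (infdist_le x Ax))// subrr normr0.
Qed.

Lemma infdist_closed A x : A !=set0 -> closed A -> infdist A x = 0 -> A x.
Proof.
move=> [a Aa] Acl d0; apply: Acl => B /nbhs_ballP[e /= e0 eB].
have [|_ [b Ab <-]] := @inf_adherent _ [set `|x - a| | a in A] e e0.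
  by split; [exists `|x - a|, a|exists 0; exact: lbound0].
rewrite -/(infdist A x) d0 add0r => xb; exists b; split => //.
by apply: eB; rewrite -ball_normE.
Qed.

Lemma infdist_lipschitz A x y : infdist A x <= `|x - y| + infdist A y.
Proof.
have [->|/set0P[a Aa]] := eqVneq A set0.
  by rewrite /infdist !image_set0 inf0 addr0.
rewrite -lerBlDl; apply: lb_le_inf; first by exists `|y - a|, a.
move=> _ [b Ab <-]; rewrite lerBlDl (le_trans (infdist_le x Ab))//.
exact: ler_distD.
Qed.

Lemma infdist_continuous A : continuous (infdist A).
Proof.
move=> x; apply/cvgrPdist_lt => e e0; apply/nbhs_ballP; exists e => //= y.
rewrite -ball_normE /= => xy; apply: le_lt_trans xy.
rewrite ler_distl lerBlDr addrC [X in _ && (_ <= X)]addrC infdist_lipschitz.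
by rewrite distrC infdist_lipschitz.
Qed.

End InfDist.

(** * Closed covers of the standard simplex *)

Section KKM.
Context {R : realType} {n : nat}.
Implicit Types x y : 'rV[R]_n.

Definition simplex : set 'rV[R]_n :=
  [set x | (forall i, 0 <= x 0 i) /\ \sum_i x 0 i = 1].

Lemma simplex_compact : compact simplex.
Proof.
have box : compact [set v : 'rV[R]_n | forall i, `[0 : R, 1]%classic (v ord0 i)].
  by apply: (@rV_compact R n (fun=> `[0, 1]%classic)) => _; exact: segment_compact.
apply: subclosed_compact box _ => [|x [x0 x1] i]; last first.
  rewrite /= in_itv/= x0 -x1 (bigD1 i)//= lerDl sumr_ge0// => j _; exact: x0.
have -> : simplex = (\bigcap_i [set x : 'rV[R]_n | 0 <= x 0 i]) `&`
    ((fun x : 'rV[R]_n => \sum_i x 0 i) @^-1` [set 1]).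
  by apply/seteqP; split => x [h1 h2]; split => // i; [move=> _|]; exact: h1.
apply: closedI.
  apply: closed_bigI => i _.
  apply: (@preimage_closed _ _ (fun x : 'rV[R]_n => x 0 i) [set t | 0 <= t]).
    by move=> x _; exact: coord_continuous.
  exact: closed_ge.
apply: (@preimage_closed _ _ (fun x : 'rV[R]_n => \sum_i x 0 i) [set 1]).
  move=> x _; apply: continuous_big; first exact: add_continuous.
  by move=> i _; exact: coord_continuous.
exact: closed_eq.
Qed.

Definition grid_point N (p : grid n N) : 'rV[R]_n :=
  \row_i ((grid_coord p i)%:R / N%:R).

Lemma grid_point_simplex N (p : grid n N.+1) : simplex (grid_point p).
Proof.
split=> [i|]; first by rewrite mxE divr_ge0.
under eq_bigr do rewrite mxE.
by rewrite -mulr_suml -natr_sum sum_grid_coord divff ?pnatr_eq0.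
Qed.

(* By dominance, a colorful room on the grid of mesh [1/N] has diameter at most
   [n/N] and lies within [n/N] of the faces of the missing colors. *)
Lemma covering (F : 'I_n -> set 'rV[R]_n) : (0 < n)%N ->
  (forall i, closed (F i)) ->
  (forall x, simplex x -> exists i, F i x) ->
  (forall i x, simplex x -> x 0 i = 0 -> F i x) ->
  exists2 x, simplex x & forall i, F i x.
Proof.
move=> n0 Fcl Fcov Fface.
have /choice[u uP] (k : nat) : exists x, simplex x /\ forall i,
    (exists2 y, F i y & forall j, `|x 0 j - y 0 j| <= n%:R / k.+1%:R) \/
    x 0 i <= n%:R / k.+1%:R.
  have /choice[c cP] (p : grid n k.+1) : exists i, F i (grid_point p).
    exact/Fcov/grid_point_simplex.
  have [p pP] := grid_room c n0.
  exists (grid_point p); split; first exact: grid_point_simplex.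
  move=> i; have [[q cq pq]|pi] := pP i; [left|right].
    exists (grid_point q) => [|j]; first by rewrite -cq.
    rewrite !mxE -mulrBl normrM (@ger0_norm _ (_^-1)) ?invr_ge0//.
    rewrite ler_wpM2r ?invr_ge0//.
    have /andP[h1 h2] := pq j.
    by rewrite ler_distl lerBlDr -!natrD !ler_nat h2 h1.
  by rewrite mxE ler_wpM2r ?invr_ge0// ler_nat.
have [x [sx xcl]] : simplex `&` cluster (u @ \oo) !=set0.
  apply: simplex_compact; exists 0%N => // k _; exact: (uP k).1.
(* Outside [F i], the point [x] has a positive coordinate [i] and a ball missing [F i]; a late term
   [u l] near [x] then satisfies neither alternative of [uP]. *)
exists x => // i; apply: contrapT => Fix.
have xi0 : 0 < x 0 i.
  by rewrite lt_neqAle sx.1 andbT; apply/negP => /eqP/esym/(Fface i x sx).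
have /nbhs_ballP[e /= e0 eF] : nbhs x (~` F i).
  by apply: open_nbhs_nbhs; split => //; rewrite openC.
(* Half of each margin: one [d] for the distance from [x] to [u l], one for the grid error. *)
pose d := Num.min e (x 0 i) / 2.
have d0 : 0 < d by rewrite divr_gt0// lt_min e0.
have dn0 : 0 < d / n%:R by rewrite divr_gt0// ltr0n.
have [k _ kP] := near_infty_natSinv_lt (PosNum dn0).
have [_ [[l kl <-] ul]] := xcl (u @` [set l | (k <= l)%N]) (ball x d)
  (ex_intro2 _ _ k I (fun l h => ex_intro2 _ _ l h erefl)) (nbhsx_ballx _ _ d0).
have nl : n%:R / l.+1%:R < d.
  by have /= := kP l kl; rewrite ltr_pdivlMr ?ltr0n// mulrC.
have ulj j : `|x 0 j - u l 0 j| < d by exact: ul.2.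
have de : d + d <= e by rewrite -splitr ge_min lexx.
have dx : d + d <= x 0 i by rewrite -splitr ge_min lexx orbT.
have [_ /(_ i)[[y Fy xy]|ui]] := uP l.
  apply: (eF y) => //; split => // i' j; rewrite ord1.
  apply: le_lt_trans (ler_distD (u l 0 j) _ _) _.
  by apply: lt_le_trans de; apply: ltrD => //; exact: le_lt_trans nl.
have := ulj i; rewrite ltr_distl => /andP[_]; rewrite ltNge => /negP; apply.
by apply: le_trans dx; rewrite lerD2r (le_trans ui)// ltW.
Qed.


(** Asking for an index in the support of [x] states the KKM condition for all faces at once. *)
Lemma KKM (A : 'I_n -> set 'rV[R]_n) : (0 < n)%N ->
  (forall i, closed (A i)) ->
  (forall x, simplex x -> exists2 i, 0 < x 0 i & A i x) ->
  exists2 x, simplex x & forall i, A i x.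
Proof.
move=> n0 Acl Acov.
have A0 i : A i !=set0.
  have [|j] := Acov (delta_mx 0 i).
    split=> [j|]; first by rewrite mxE ler0n.
    rewrite (bigD1 i)//= mxE !eqxx big1 ?addr0// => j ji.
    by rewrite mxE (negPf ji) andbF.
  rewrite mxE eqxx/=; have [->|_] := eqVneq j i; last by rewrite ltxx.
  by exists (delta_mx 0 i).
pose g i := infdist (A i); pose S x := \sum_i g i x.
have S0 x : 0 <= S x by apply: sumr_ge0 => i _; exact: infdist_ge0.
(* At a common point of the [F i], [g i x = x 0 i * S x] for all [i], so [S x]
   vanishes because [g i x = 0] for some [i] with [0 < x 0 i]. *)
pose F i := [set x : 'rV[R]_n | 0 <= g i x - x 0 i * S x].
have Fcl i : closed (F i).
  apply: (@preimage_closed _ _ (fun x => g i x - x 0 i * S x) [set t | 0 <= t]).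
    move=> x _; apply: continuousB; first exact: infdist_continuous.
    apply: continuousM; first exact: coord_continuous.
    apply: (@continuous_big _ _ _ 0 predT); first exact: add_continuous.
    by move=> j _; exact: infdist_continuous.
  exact: closed_ge.
have [||x sx xF] := covering n0 Fcl.
- move=> x [x0 x1]; apply: contrapT => /forallNP h.
  suff : S x < S x by rewrite ltxx.
  rewrite -[ltRHS]mul1r -x1 mulr_suml; apply: ltr_sum.
    by apply/hasP; exists (Ordinal n0) => //; exact: mem_index_enum.
  move=> i _; rewrite -subr_lt0 ltNge; apply/negP; exact: h.
- move=> i x sx xi; rewrite /F /= xi mul0r subr0; exact: infdist_ge0.
have [x0 x1] := sx; exists x => // i.
have gE j : g j x = x 0 j * S x.
  apply/eqP; rewrite eq_le; apply/andP; split; last by rewrite -subr_ge0; exact: xF.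
  rewrite -subr_le0 (@psumr_eq0P _ _ predT (fun j => g j x - x 0 j * S x))//.
    by move=> k _; exact: xF.
  by rewrite sumrB -mulr_suml x1 mul1r subrr.
have Sx0 : S x = 0.
  have [j xj Aj] := Acov x sx.
  have /eqP := gE j; rewrite /g infdist_eq0// eq_sym mulf_eq0 gt_eqF//=.
  by move/eqP.
by apply: infdist_closed => //; rewrite -/(g i x) gE Sx0 mulr0.
Qed.

End KKM.
Arguments simplex {R} n.

(** * Hahn-Banach, Mazur and weak compactness *)

Lemma convex_setP (R : numDomainType) (E : lmodType R) (A : set E) :
  convex_set A <-> forall x y t, A x -> A y -> 0 <= t -> t <= 1 ->
    A (t *: x + (1 - t) *: y).
Proof.
split=> [cA x y t Ax Ay t0 t1|cA x y l /set_mem Ax /set_mem Ay].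
  by have := cA x y (Itv01 t0 t1) (mem_set Ax) (mem_set Ay); move/set_mem.
by apply/mem_set/cA.
Qed.

(** * Sublinear functionals and their linear minorants *)

Section Sublinear.
Context {R : realType} {X : lmodType R}.
Implicit Types (p q : X -> R) (x y : X).

Definition sublinear p := (forall x y, p (x + y) <= p x + p y) /\
  (forall t x, 0 < t -> p (t *: x) <= t * p x).

Lemma sublinear0 p : sublinear p -> p 0 = 0.
Proof.
move=> [pD pZ]; have := pD 0 0; have := pZ 2^-1 0.
rewrite scaler0 addr0 invr_gt0 ltr0n => /(_ isT) h1 h2.
by apply/eqP; rewrite eq_le; apply/andP; split; lra.
Qed.

Lemma sublinearN p x : sublinear p -> - p (- x) <= p x.
Proof.
move=> ps; have := ps.1 x (- x); rewrite subrr sublinear0// => h.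
by rewrite lerNl -subr_ge0 opprK addrC.
Qed.

Lemma sublinearZ p t x : sublinear p -> 0 < t -> p (t *: x) = t * p x.
Proof.
move=> [_ pZ] t0; apply/eqP; rewrite eq_le pZ//=.
rewrite -ler_pdivlMl//; apply: le_trans (pZ t^-1 (t *: x) _).
  by rewrite scalerA mulVf ?gt_eqF// scale1r.
by rewrite invr_gt0.
Qed.

(** One criterion for three infima: over a chain of functionals, along a half-line, and over
    multiples of a translated convex set. The bound [b] keeps them finite. *)
Lemma sublinear_inf (I : Type) (W : set I) (h : I -> X -> R) (b : X -> R) :
  W !=set0 ->
  (forall x w, W w -> b x <= h w x) ->
  (forall x y w v, W w -> W v ->
     exists2 u, W u & h u (x + y) <= h w x + h v y) ->
  (forall t x w, 0 < t -> W w -> exists2 u, W u & h u (t *: x) <= t * h w x) ->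
  sublinear (fun x => inf [set h w x | w in W]).
Proof.
move=> [w0 Ww0] hb hD hZ.
have inf_h x w : W w -> inf [set h w x | w in W] <= h w x.
  move=> Ww; apply: ge_inf; last by exists w.
  by exists (b x) => _ [v Wv <-]; exact: hb.
have h_inf x c : (forall w, W w -> c <= h w x) -> c <= inf [set h w x | w in W].
  move=> hc; apply: lb_le_inf; first by exists (h w0 x), w0.
  by move=> _ [w Ww <-]; exact: hc.
split=> [x y|t x t0].
  rewrite -lerBlDr; apply: (h_inf) => w Ww; rewrite lerBlDr -lerBlDl.
  apply: (h_inf) => v Wv; rewrite lerBlDl.
  by have [u Wu] := hD x y w v Ww Wv; apply: le_trans; exact: inf_h.
rewrite -ler_pdivrMl//; apply: (h_inf) => w Ww; rewrite ler_pdivrMl//.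
by have [u Wu] := hZ t x w t0 Ww; apply: le_trans; exact: inf_h.
Qed.

(** Zorn's lemma for the reversed pointwise order: the infimum of a nonempty chain is sublinear, and
    finite because sublinear minorants of [p] are at least [- p (- x)]. *)
Lemma sublinear_minimal p : sublinear p -> exists2 q,
  sublinear q /\ (forall x, q x <= p x) &
  forall q', sublinear q' -> (forall x, q' x <= q x) -> q' = q.
Proof.
move=> ps; pose T := {q : X -> R | sublinear q /\ forall x, q x <= p x}.
pose le (s t : T) := `[< forall x, sval t x <= sval s x >].
have [||||[q [qs qp]] qmin] := @Zorn T le.
- by move=> t; apply/asboolP.
- move=> r s t /asboolP rs /asboolP st; apply/asboolP => x.
  exact: le_trans (st x) (rs x).
- move=> [s sP] [t tP] /asboolP/= st /asboolP/= ts; apply: eq_exist.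
  by apply/funext => x; apply/eqP; rewrite eq_le st ts.
- move=> A Atot; have [->|A0] := eqVneq A set0.
    by exists (exist _ p (conj ps (fun x => lexx (p x)))).
  have inf_le s x : A s -> inf [set sval s x | s in A] <= sval s x.
    move=> As; apply: ge_inf; last by exists s.
    exists (- p (- x)) => _ [[q [qs qp]] _ <-] /=.
    by apply: le_trans (sublinearN x qs); rewrite lerN2.
  have ms : sublinear (fun x => inf [set sval s x | s in A]).
    apply: (@sublinear_inf _ A (fun s : T => sval s) (fun x => - p (- x))).
    + exact/set0P.
    + move=> x [q [qs qp]] _ /=.
      by apply: le_trans (sublinearN x qs); rewrite lerN2.
    + move=> x y s t As At; have [/asboolP st|/asboolP ts] := Atot s t As At.
        exists t => //; apply: le_trans ((svalP t).1.1 _ _) _.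
        by rewrite lerD2r.
      exists s => //; apply: le_trans ((svalP s).1.1 _ _) _.
      by rewrite lerD2l.
    + by move=> t x s t0 As; exists s => //; exact: (svalP s).1.2.
  have /set0P[s0 As0] := A0.
  have mp x : inf [set sval s x | s in A] <= p x.
    exact: le_trans (inf_le _ x As0) ((svalP s0).2 x).
  exists (exist _ (fun x => inf [set sval s x | s in A]) (conj ms mp)) => s As.
  apply/asboolP => x /=.
  exact: inf_le.
- exists q => // q' q's q'q.
  have q'p x : q' x <= p x by exact: le_trans (q'q x) (qp x).
  by have /(congr1 sval) := qmin (exist _ q' (conj q's q'p)) (introT (asboolP _) q'q).
Qed.

(* A minimal sublinear [q] is additive, since
   [x |-> inf_t q (x + t y) - t q y] is a
   sublinear minorant of [q]. *)
Lemma sublinear_linear p : sublinear p ->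
  exists2 f : X -> R^o, linear f & forall x, f x <= p x.
Proof.
move=> /sublinear_minimal[q [qs qp] qmin]; exists q => //.
have qD_ge y x : q x + q y <= q (x + y).
  have := qmin (fun x => inf [set q (x + t *: y) - t * q y | t in [set t | 0 <= t]]).
  have lb z t : 0 <= t -> - q (- z) <= q (z + t *: y) - t * q y.
    move=> t0; rewrite lerBrDr addrC lerBlDr.
    have -> : t * q y = q (t *: y).
      move: t0; rewrite le_eqVlt => /orP[/eqP <-|t0].
        by rewrite mul0r scale0r sublinear0.
      by rewrite sublinearZ.
    by apply: le_trans (qs.1 _ _); rewrite addrAC subrr add0r.
  have inf_le z t : 0 <= t ->
      inf [set q (z + t *: y) - t * q y | t in [set t | 0 <= t]] <=
      q (z + t *: y) - t * q y.
    move=> t0; apply: ge_inf; last by exists t.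
    by exists (- q (- z)) => _ [s s0 <-]; exact: lb.
  (* By minimality the infimum is [q] itself. The value at [t = 1] gives the claim; the value at
     [t = 0] shows that the infimum is below [q]. *)
  move=> /(_ _ _)/(congr1 (fun g => g x)) <-.
  - by rewrite -lerBrDr -[X in q (_ + X)]scale1r -[X in _ - X]mul1r inf_le.
  - apply: (@sublinear_inf _ [set t | 0 <= t] (fun t x => q (x + t *: y) - t * q y)
      (fun x => - q (- x))) => //.
    + by exists 0 => /=.
    + move=> u v s t /= s0 t0; exists (s + t); first exact: addr_ge0.
      rewrite scalerDl addrACA [leRHS]addrACA -opprD -mulrDl lerD2r.
      exact: qs.1.
    + move=> t u s t0 /= s0; exists (t * s); first by rewrite mulr_ge0// ltW.
      by rewrite /= -scalerA -scalerDr -mulrA mulrBr lerD2r; exact: qs.2.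
  - by move=> z; have := inf_le z 0 (lexx _); rewrite scale0r addr0 mul0r subr0.
have qD x y : q (x + y) = q x + q y.
  by apply/eqP; rewrite eq_le qs.1 qD_ge.
have qN x : q (- x) = - q x.
  by apply/eqP; rewrite -addr_eq0 -qD addNr sublinear0.
move=> a x y; rewrite qD; congr (_ + _).
have [a0|a0|->] := ltgtP a 0; last by rewrite !scale0r sublinear0.
  rewrite -[a]opprK scaleNr qN sublinearZ ?oppr_gt0//.
  by rewrite [RHS]mulNr.
exact: sublinearZ.
Qed.

End Sublinear.

Lemma dual_of_bounded (R : realType) (X : normedModType R) (f : X -> R^o)
    (M : R) : linear f -> (forall x, f x <= M * `|x|) ->
  exists g : dual X, forall x, g x = f x.
Proof.
move=> fl fM; pose L := GRing.isLinear.Build R X R^o _ f fl.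
pose F : {linear X -> R^o} := HB.pack f L.
have fN x : `|f x| <= M * `|x|.
  rewrite ler_norml fM andbT lerNl -(linearN F) -(normrN x).
  exact: fM.
have fd : f \in is_dual (V := X).
  apply/asboolP; split => //; apply: (@bounded_linear_continuous _ _ _ F).
  apply/ex_bound; exists (Num.max M 0).
  apply/nbhs_ballP; exists 1 => //= x; rewrite -ball_normE/= sub0r normrN => x1.
  apply: le_trans (fN x) _; rewrite le_max.
  have [M0|M0] := leP M 0; first by rewrite mulr_le0_ge0// orbT.
  by rewrite ler_piMr// ltW.
by exists (Dual fd).
Qed.

Lemma ultra_fmap (T U : Type) (f : T -> U) (F : set_system T) :
  UltraFilter F -> UltraFilter (f @ F).
Proof.
move=> FU; split; first exact: fmap_proper_filter.
move=> G GF FG; apply/seteqP; split => // A GA.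
have [//|FnA] := in_ultra_setVsetC (f @^-1` A) FU.
by have /filter_ex[? []] : G (A `&` ~` A) by apply: filterI => //; exact: FG.
Qed.

(** * Separation and the weak topology *)

Section Mazur.
Context {R : realType} {X : normedModType R}.
Implicit Types (K : set X) (x : X).

(* The sublinear [p] is at most the norm, and at most [- delta] at each [x0 - k]. *)
Lemma separation K x0 (delta : R) : convex_set K -> K !=set0 ->
  (forall k, K k -> delta <= `|k - x0|) ->
  exists f : dual X, forall k, K k -> f x0 + delta <= f k.
Proof.
move=> /convex_setP Kc [k0 Kk0] Kd.
pose W := [set w : R * X | 0 <= w.1 /\ K w.2].
pose h (w : R * X) x := `|x + w.1 *: (w.2 - x0)| - w.1 * delta.
pose p x := inf [set h w x | w in W].
have hlb x w : W w -> - `|x| <= h w x.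
  case: w => t k [/= t0 Kk]; rewrite /h /=.
  have : t * delta <= `|t *: (k - x0)|.
    by rewrite normrZ ger0_norm// ler_wpM2l// Kd.
  have := lerB_normD (t *: (k - x0)) x; rewrite addrC [x + _]addrC.
  by move=> h1 h2; lra.
have ps : sublinear p.
  apply: (@sublinear_inf _ _ _ W h (fun x => - `|x|)) => //.
  - by exists (0, k0); split=> /=.
  - move=> x y [t k] [s l] [/= t0 Kk] [/= s0 Kl].
    have [ts0|ts0] := eqVneq (t + s) 0.
      exists (0, k0); first by split => /=.
      have tE : t = 0 by lra.
      have sE : s = 0 by lra.
      rewrite /h /= tE sE !scale0r !mul0r !addr0 !subr0.
      exact: ler_normD.
    have tsgt : 0 < t + s by rewrite lt_neqAle eq_sym ts0 addr_ge0.
    (* Weights proportional to [t] and [s] merge the two pairs into one, by convexity of [K]. *)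
    exists (t + s, (t / (t + s)) *: k + (1 - t / (t + s)) *: l).
      split; first exact: ltW.
      apply: Kc => //; first by rewrite divr_ge0// ltW.
      by rewrite ler_pdivrMr// mul1r lerDl.
    rewrite /h /= mulrDl opprD [leRHS]addrACA lerD2r.
    apply: le_trans (ler_normD _ _); rewrite le_eqVlt; apply/orP; left.
    apply/eqP; congr `|_|.
    rewrite addrACA; congr (_ + _).
    rewrite !scalerBr scalerDr !scalerA mulrBr mulr1.
    have -> : (t + s) * (t / (t + s)) = t by rewrite mulrC divfK.
    by rewrite [t + s - t]addrC addrA addNr add0r scalerDl opprD addrACA.
  - move=> t x [s k] t0 [/= s0 Kk]; exists (t * s, k).
      by split=> //=; rewrite mulr_ge0// ltW.
    by rewrite /h /= -scalerA -scalerDr normrZ gtr0_norm// -mulrA mulrBr.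
have [f fl fp] := sublinear_linear ps.
have ple w x : W w -> p x <= h w x.
  move=> Ww; apply: ge_inf; last by exists w.
  by exists (- `|x|) => _ [v Wv <-]; exact: hlb.
have pn x : p x <= `|x|.
  apply: le_trans (ple (0, k0) x _) _; first by split => /=.
  by rewrite /h /= scale0r addr0 mul0r subr0.
have [g gf] : exists g : dual X, forall x, g x = f x.
  by apply: (@dual_of_bounded R X f 1 fl) => x; rewrite mul1r (le_trans (fp x)).
exists g => k Kk.
have := le_trans (fp (x0 - k)) (ple (1, k) _ (conj ler01 Kk)).
rewrite /h /= scale1r addrA subrK subrr normr0 sub0r mul1r -gf linearB/=.
by move=> h1; lra.
Qed.

Lemma weak_dual_continuous (f : dual X) :
  continuous (f : weak_topology X -> R^o).
Proof.
move=> x; have /cvg_sup/(_ f) h : nbhs (x : weak_topology X) --> (x : weak_topology X).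
  exact: cvg_id.
apply: cvg_trans (@initial_continuous X R^o f x).
exact: cvg_app.
Qed.

Lemma weak_nbhs (x : X) (F : set_system X) : Filter F ->
  (forall f : dual X, f @ F --> f x) -> F --> (x : weak_topology X).
Proof.
move=> FF Ff; apply/cvg_sup => f A.
have /= -> := @nbhsE (initial_topology f) x.
case=> [B [[C oC <-] Cx] BA]; apply: filterS BA _.
by apply: Ff; exact: open_nbhs_nbhs.
Qed.

Lemma nbhs_weak_norm (x : X) (U : set X) :
  nbhs (x : weak_topology X) U -> nbhs x U.
Proof.
have : nbhs x --> (x : weak_topology X).
  by apply: weak_nbhs => f; exact: dual_continuous.
exact.
Qed.

(** Mazur: a functional separates [K] from [x] with gap [e], the radius of a ball missing [K], and
    the half-space below [f x + e] is a weak neighborhood of [x] missing [K]. *)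
Lemma closed_convex_weak K : convex_set K -> closed K ->
  closed (K : set (weak_topology X)).
Proof.
move=> Kc Kcl x xK; apply: contrapT => Kx.
have K0 : K !=set0.
  by have [y []] := xK setT filterT; exists y.
have /nbhs_ballP[e /= e0 eK] : @nbhs X X x (~` K).
  by apply: open_nbhs_nbhs; split => //; rewrite openC.
have [k Kk|f fK] := @separation K x e Kc K0.
  rewrite leNgt; apply/negP => ke; apply: (eK k) => //.
  by rewrite -ball_normE /= distrC.
have [y [Ky /=]] : K `&` [set y | (f y : R) < f x + e] !=set0.
  apply: xK; apply: (@weak_dual_continuous f x [set t : R | t < f x + e]).
  by apply: open_nbhs_nbhs; split; [exact: open_lt|rewrite /= ltrDl].
by rewrite ltNge fK.
Qed.

(** Along an ultrafilter on [K] each functional converges, its values lying in a compact interval.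
    The limits form a bounded linear functional on the dual, which reflexivity represents by a
    point; Mazur puts this point in [K]. *)
Lemma weak_compact K (M : R) : reflexive_space X -> convex_set K -> closed K ->
  (forall x, K x -> `|x| <= M) -> compact (K : set (weak_topology X)).
Proof.
move=> Xr Kc Kcl KM; rewrite compact_ultra => F FU FK.
have FP : ProperFilter F := @ultra_proper _ F FU.
pose b (f : dual X) := dual_norm f * Num.max M 0.
have fb (f : dual X) x : K x -> `|f x| <= b f.
  move=> Kx; apply: le_trans (le_dual_norm f x) _.
  rewrite ler_wpM2l ?dual_norm_ge0//.
  by rewrite le_max KM.
have /choice[phi phiP] (f : dual X) : exists t : R^o, `|t| <= b f /\ f @ F --> t.
  have := @segment_compact R (- b f) (b f); rewrite compact_ultra.
  move=> /(_ (f @ F) (ultra_fmap f FU))[|t [tb ft]].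
    suff : F (f @^-1` `[- b f, b f]) by [].
    apply: filterS FK => x Kx /=.
    by have := fb f x Kx; rewrite ler_norml in_itv.
  by exists t; split => //; move: tb; rewrite /= in_itv /= -ler_norml.
have phil : linear phi.
  move=> a f g; have [_ h] := phiP (a *: f + g).
  apply: (@cvg_unique _ _ _ _ _ _ h); first exact: norm_hausdorff.
  apply: cvgD; last exact: (phiP g).2.
  by apply: cvgZl_tmp; exact: (phiP f).2.
have [Phi PhiE] : exists g : dual (dual X), forall f, g f = phi f.
  apply: (@dual_of_bounded R (dual X) phi (Num.max M 0) phil) => f.
  by rewrite mulrC; apply: le_trans (ler_norm _) (phiP f).1.
have [x xPhi] := Xr Phi.
have Fx : F --> (x : weak_topology X).
  by apply: weak_nbhs => f; rewrite -xPhi PhiE; exact: (phiP f).2.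
exists x; split => //; apply: (closed_convex_weak Kc Kcl) => B xB.
by apply: (@filter_ex _ F); apply: filterI => //; exact: Fx.
Qed.

End Mazur.

(** * Densely defined equilibrium problems *)

Lemma convex_sum (R : realType) (E : lmodType R) (A : set E) n
    (y : 'I_n -> E) (l : 'I_n -> R) : convex_set A ->
  (forall i, A (y i)) -> (forall i, 0 <= l i) -> \sum_i l i = 1 ->
  A (\sum_i l i *: y i).
Proof.
move=> /convex_setP Ac Ay l0 l1.
(* The induction needs arbitrary positive total weight, hence the normalizing factor. *)
suff : A ((\sum_i l i)^-1 *: \sum_i l i *: y i) by rewrite l1 invr1 scale1r.
have : 0 < \sum_i l i by rewrite l1.
elim: n y l Ay l0 {l1} => [|n IH] y l Ay l0; first by rewrite big_ord0 ltxx.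
rewrite !big_ord_recl /=.
set S := \sum_(i < n) _; set Y := \sum_(i < n) _ => SS.
have S0 : 0 <= S by apply: sumr_ge0.
have [/eqP|Spos] := eqVneq S 0.
  move=> Se0; have Yl i : l (lift ord0 i) = 0.
    apply/eqP; move: Se0; rewrite psumr_eq0// => /allP/(_ i) /=.
    by rewrite mem_index_enum => /(_ isT).
  have -> : Y = 0 by rewrite /Y big1// => i _; rewrite Yl scale0r.
  rewrite (eqP Se0) !addr0 scalerA mulVf ?scale1r//.
  by rewrite gt_eqF//; move: SS; rewrite (eqP Se0) addr0.
have Sgt : 0 < S by rewrite lt_neqAle eq_sym Spos.
have := IH _ _ (fun i => Ay (lift ord0 i)) (fun i => l0 (lift ord0 i)) Sgt.
rewrite -/S -/Y => AY.
have := Ac _ _ (l ord0 / (l ord0 + S)) (Ay ord0) AY.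
rewrite divr_ge0 ?(ltW SS)// => /(_ isT).
rewrite ler_pdivrMr// mul1r lerDl => /(_ S0).
congr A; rewrite scalerDr !scalerA [in RHS]mulrC; congr (_ + _ *: _).
by field; rewrite gt_eqF// gt_eqF.
Qed.

(** * Strictly negative values in the cone order *)

Section ConeFacts.
Context {R : realType} {Z : lmodType R}.
Variable C : set Z.
Hypotheses (C_convex : convex_cone C) (C_pointed : pointed_cone C).

Definition strictly_negative (z : Z) := ([set - c | c in C] `\ 0) z.

Lemma strictly_negativeP z : strictly_negative z <-> C (- z) /\ z <> 0.
Proof.
split=> [[[c Cc <-] z0]|[Cz z0]]; first by rewrite opprK.
by split=> //; exists (- z); rewrite ?opprK.
Qed.

Lemma cone0 : C 0.
Proof. by have : [set (0 : Z)] 0 by []; rewrite -C_pointed => -[]. Qed.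

Lemma coneD a b : C a -> C b -> C (a + b).
Proof. by move=> Ca Cb; rewrite -C_convex.2; exists a => //; exists b. Qed.

Lemma coneZ t a : 0 <= t -> C a -> C (t *: a).
Proof. by move=> t0 Ca; exact: C_convex.1. Qed.

Lemma cone_pointed a : C a -> C (- a) -> a = 0.
Proof.
move=> Ca CNa; have : (C `&` [set - c | c in C]) a.
  by split => //; exists (- a); rewrite ?opprK.
by rewrite C_pointed.
Qed.

Lemma strictly_negativeZ t z : 0 < t -> strictly_negative z ->
  strictly_negative (t *: z).
Proof.
move=> t0 /strictly_negativeP[Cz z0]; apply/strictly_negativeP; split.
  by rewrite -scalerN; apply: coneZ => //; exact: ltW.
by move/eqP; rewrite scaler_eq0 gt_eqF//= => /eqP.
Qed.

(** [- y] is the sum of [z - y] and [- z]; if [y] were 0, both [z] and [- z] would lie in the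
    pointed cone. *)
Lemma strictly_negative_le y z : cone_le C y z -> strictly_negative z ->
  strictly_negative y.
Proof.
rewrite /cone_le => Cyz /strictly_negativeP[Cz z0]; apply/strictly_negativeP.
split=> [|y0]; first by have := coneD Cyz Cz; rewrite addrAC subrr add0r.
by apply: z0; apply: cone_pointed => //; move: Cyz; rewrite y0 subr0.
Qed.

(** Some weight is positive, and the sum lies below that single strictly negative term. *)
Lemma strictly_negative_sum n (l : 'I_n -> R) (z : 'I_n -> Z) :
  (forall i, 0 <= l i) -> \sum_i l i = 1 ->
  (forall i, 0 < l i -> strictly_negative (z i)) ->
  strictly_negative (\sum_i l i *: z i).
Proof.
move=> l0 l1 zneg.
have [i li] : exists i, 0 < l i.
  apply: contrapT => /forallNP h; have := oner_neq0 R.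
  rewrite -l1 big1 ?eqxx// => i _; apply/eqP; rewrite eq_le l0 andbT leNgt.
  exact/negP.
apply: (@strictly_negative_le _ (l i *: z i)); last first.
  exact/strictly_negativeZ/zneg.
rewrite /cone_le (bigD1 i)//= opprD addrA subrr add0r -sumrN.
apply: (big_ind C) => [||j _]; [exact: cone0|exact: coneD|].
have := l0 j; rewrite le_eqVlt => /orP[/eqP <-|lj].
  by rewrite scale0r oppr0; exact: cone0.
by have /strictly_negativeP[] := strictly_negativeZ lj (zneg j lj).
Qed.

(** Semicontinuity with [k = - g x] makes [g x + k] vanish. *)
Lemma strictly_negative_open (E : topologicalType) (K : set E) (g : E -> Z) x :
  strongly_usc_at C K g x -> strictly_negative (g x) ->
  exists2 U, nbhs x U & forall u, (U `&` K) u -> strictly_negative (g u).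
Proof.
move=> gx /strictly_negativeP[Cx x0].
have [|U xU UK] := gx (- g x).
  by split=> // /eqP; rewrite oppr_eq0 => /eqP.
exists U => // u /UK[c [Cc c0] <-]; rewrite subrr sub0r.
by apply/strictly_negativeP; rewrite opprK; split=> // /eqP; rewrite oppr_eq0 => /eqP.
Qed.

Lemma cone_convex_on2 (E : lmodType R) (K : set E) (g : E -> Z) x y t :
  convex_set K -> cone_convex_on C K g -> K x -> K y -> 0 <= t -> t <= 1 ->
  cone_le C (g (t *: x + (1 - t) *: y)) (t *: g x + (1 - t) *: g y).
Proof.
move=> /convex_setP Kc gc Kx Ky t0 t1.
have := gc 2 (fun i => if i == ord0 then x else y)
  (fun i => if i == ord0 then t else 1 - t).
rewrite !big_ord_recl !big_ord0 /= !addr0; apply.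
- by move=> i; case: ifP.
- by move=> i; case: ifP => // _; rewrite subr_ge0.
- by rewrite addrC subrK.
- exact: Kc.
Qed.

End ConeFacts.

(** * From weak to norm density *)

Section Density.
Context {R : realType} {X : normedModType R}.

(** For a functional with [f (y - x) != 0], distances along the segment are proportional to
    differences of [f], so a weak neighborhood given by [f] controls the norm. *)
Lemma segment_dense_norm (D : set X) (x y z : X) :
  closure (segment x y `&` D : set (weak_topology X)) z ->
  segment x y z -> closure D z.
Proof.
move=> zcl [t _ zE].
have [xy|xy] := eqVneq x y.
  have [u [[[s _ <-] Du] _]] := zcl setT filterT.
  by apply: subset_closure; move: Du; rewrite -zE xy subrr !scaler0.
have [f fxy] : exists f : dual X, f (y - x) != 0.
  have [|||f fP] := @separation R X [set y] x `|y - x|.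
  - apply/convex_setP => _ _ s -> -> _ _; by rewrite -scalerDl addrC subrK scale1r.
  - by exists y.
  - by move=> _ ->.
  exists f; rewrite linearB subr_eq0 gt_eqF//.
  apply: lt_le_trans (fP y erefl); rewrite ltrDl normr_gt0 subr_eq0.
  by rewrite eq_sym.
move=> B /nbhs_ballP[e /= e0 eB].
have nxy : 0 < `|y - x| by rewrite normr_gt0 subr_eq0 eq_sym.
pose d := e / `|y - x| * `|f (y - x)|.
have d0 : 0 < d by rewrite mulr_gt0 ?divr_gt0// normr_gt0.
have [_ [[[s _ <-] Du] /= fu]] := zcl _
  (@weak_dual_continuous R X f z _ (nbhsx_ballx (f z : R^o) d d0)).
exists (x + s *: (y - x)); split => //; apply: eB.
move: fu; rewrite -zE -!ball_normE /=.
rewrite -linearB !opprD !addrA [x + _ - x]addrAC subrr add0r -scalerBl.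
rewrite linearZ /= normrM normrZ /d ltr_pM2r ?normr_gt0//.
by rewrite ltr_pdivlMr.
Qed.

(* On a segment the weak and norm topologies agree, so the norm closure of [D] is
   convex and hence weakly closed. *)
Lemma self_segment_dense_norm (D K : set X) :
  self_segment_dense (D : set (weak_topology X)) K -> K `<=` closure D.
Proof.
move=> [KD Dseg].
have clD : convex_set (closure D).
  apply/convex_setP => a b t aD bD t0 t1 B /nbhs_ballP[e /= e0 eB].
  (* One half of [e] is for the endpoints, the other for approximating [z] by a point of [D]. *)
  have [x [Dx]] := aD _ (nbhsx_ballx a (e / 2) (divr_gt0 e0 (ltr0n _ 2))).
  have [y [Dy]] := bD _ (nbhsx_ballx b (e / 2) (divr_gt0 e0 (ltr0n _ 2))).
  rewrite -!ball_normE /= => byl axl.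
  pose z := t *: x + (1 - t) *: y.
  have zs : segment y x z.
    exists t; first by rewrite /= in_itv/= t0.
    by rewrite /z scalerBl scale1r scalerBr addrCA.
  have zcl := segment_dense_norm (Dseg y x Dy Dx z zs) zs.
  have [d [Dd]] := zcl _ (nbhsx_ballx z (e / 2) (divr_gt0 e0 (ltr0n _ 2))).
  rewrite -ball_normE /= => zd; exists d; split => //; apply: eB.
  rewrite -ball_normE /= (splitr e); apply: le_lt_trans (ler_distD z _ _) _.
  apply: ltrD => //; rewrite /z opprD addrACA -!scalerBr.
  apply: le_lt_trans (ler_normD _ _) _; rewrite !normrZ !ger0_norm ?subr_ge0//.
  have : t * `|a - x| + (1 - t) * `|b - y| <= Num.max `|a - x| `|b - y|.
    set M := Num.max _ _; have -> : M = t * M + (1 - t) * M by ring.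
    by apply: lerD; rewrite ler_wpM2l ?subr_ge0// /M le_max lexx ?orbT.
  by move=> /le_lt_trans; apply; rewrite gt_max axl.
have := closed_convex_weak clD (@closed_closure _ D).
rewrite /closed => clDw x /KD xD; apply: clDw => B /xD[y [Dy By]].
by exists y; split => //; exact: subset_closure.
Qed.

End Density.

(** KKM is applied to the sets pulled back along [comb], closed since weak neighborhoods are norm
    neighborhoods. If [f x (y i)] were strictly negative on the whole support of [x = comb l],
    convexity would make [f x x = 0] strictly negative. *)
Lemma KKM_equilibrium (R : realType) (X : normedModType R) (Z : lmodType R)
  (C : set Z) (K K0 D : set X) (f : X -> X -> Z) n (y : 'I_n -> X) :
  convex_cone C -> pointed_cone C -> convex_set K0 -> K0 `<=` K ->
  (forall y, D y ->
    strongly_usc_on C (K : set (weak_topology X)) K (fun x => f x y)) ->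
  (forall x, K x -> cone_convex_on C K (fun y => f x y)) ->
  (forall x, K x -> f x x = 0) ->
  (0 < n)%N -> (forall i, D (y i) /\ K0 (y i)) ->
  exists2 x, K0 x & forall i, ~ strictly_negative C (f x (y i)).
Proof.
move=> Cc Cp K0c K0K fusc fconv fdiag n0 yP.
pose comb (l : 'rV[R]_n) := \sum_i l 0 i *: y i.
have combK l : simplex n l -> K0 (comb l).
  by move=> [l0 l1]; apply: convex_sum => // i; exact: (yP i).2.
have comb_cont : continuous comb.
  move=> l; apply: (@continuous_big X _ _ 0 predT); first exact: add_continuous.
  by move=> i _ m; exact: (cvgZr_tmp (@coord_continuous R 1 n 0 i m)).
pose A i := [set l | simplex n l /\ ~ strictly_negative C (f (comb l) (y i))].
have [||l sl lA] := @KKM R n A n0.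
- move=> i l lcl; have sl : simplex n l.
    apply: (compact_closed (@norm_hausdorff _ _) simplex_compact) => B lB.
    by have [m [[sm _] Bm]] := lcl B lB; exists m.
  split => // neg; have Kl := K0K _ (combK l sl).
  have [U lU UK] := strictly_negative_open (fusc _ (yP i).1 _ Kl) neg.
  have [m [[sm Am] /= Um]] := lcl _ (comb_cont l _ (nbhs_weak_norm lU)).
  by apply/Am/UK; split => //; exact/K0K/combK.
- move=> l sl; apply: contrapT => h; have [l0 l1] := sl.
  have neg i : 0 < l 0 i -> strictly_negative C (f (comb l) (y i)).
    move=> li; apply: contrapT => nneg; apply: h.
    by exists i => //.
  have Kl := K0K _ (combK l sl).
  have := strictly_negative_sum Cc Cp l0 l1 neg.
  have := fconv _ Kl n y (fun i => l 0 i) (fun i => K0K _ (yP i).2) l0 l1 Kl.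
  move=> /(strictly_negative_le Cc Cp) /[apply].
  by rewrite -/(comb l) fdiag// => /strictly_negativeP[].
- by exists (comb l) => [|i]; [exact: combK|exact: (lA i).2].
Qed.

Theorem theorem4p5 (R : realType) (X : completeNormedModType R) (Z : tvsType R)
  (C : set Z) (K D : set X) (f : X -> X -> Z)
  (X_reflexive : reflexive_space X)
  (Z_hausdorff : hausdorff_space Z)
  (C_convex : convex_cone C) (C_pointed : pointed_cone C)
  (K_nonempty : K !=set0) (K_convex : convex_set K) (K_closed : closed K)
  (D_sub_K : D `<=` K)
  (D_dense : self_segment_dense (D : set (weak_topology X)) K)
  (f_usc_l : forall y, D y ->
    strongly_usc_on C (K : set (weak_topology X)) K (fun x => f x y))
  (f_usc_r : forall x, K x ->
    strongly_usc_on C (K : set (weak_topology X)) (K `\` D) (fun y => f x y))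
  (f_convex : forall x, K x -> cone_convex_on C K (fun y => f x y))
  (f_diag : forall x, K x -> f x x = 0)
  (f_coercive : exists2 r : R, 0 < r &
    forall x, K x -> r < `|x| -> exists y0,
      [/\ K y0, `|y0| < `|x| & [set - c | c in C] (f x y0)]) :
  exists2 x0, K x0 &
    forall y, K y -> ~ ([set - c | c in C] `\ 0) (f x0 y).
Proof.
have [r r0 coer] := f_coercive.
have [k Kk] := K_nonempty.
pose M := Num.max r `|k| + 1.
have rM : r < M by rewrite /M ltr_pwDr// le_max lexx.
have kM : `|k| < M by rewrite /M ltr_pwDr// le_max lexx orbT.
pose K0 := K `&` [set x | `|x| <= M].
have K0c : convex_set K0.
  have /convex_setP Kc := K_convex.
  apply/convex_setP => x y t [Kx xM] [Ky yM] t0 t1; split; first exact: Kc.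
  rewrite /= (le_trans (ler_normD _ _))// !normrZ !ger0_norm ?subr_ge0//.
  have -> : M = t * M + (1 - t) * M by ring.
  by apply: lerD; rewrite ler_wpM2l ?subr_ge0.
have K0cl : closed K0.
  apply: closedI => //.
  apply: (@preimage_closed _ _ (fun x : X => `|x|) [set t : R | t <= M]).
    by move=> x _; exact: norm_continuous.
  exact: closed_le.
have K0compact : compact (K0 : set (weak_topology X)).
  by apply: (@weak_compact R X K0 M) => // x [].
pose G y : set (weak_topology X) :=
  [set x | K0 x /\ ~ strictly_negative C (f x y)].
have [x0 x0G] : \bigcap_(y in D `&` K0) G y !=set0.
  have := K0compact; rewrite compact_In0; apply.
    exists G => y [Dy _]; last by apply/seteqP; split => x [].
    move=> x xcl; have K0x : K0 x.
      apply: (closed_convex_weak K0c K0cl) => B xB.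
      by have [z [[K0z _] Bz]] := xcl B xB; exists z.
    split => // neg.
    have [U xU UK] := strictly_negative_open (f_usc_l _ Dy _ K0x.1) neg.
    have [z [[K0z zneg] Uz]] := xcl U xU.
    by apply: zneg; apply: UK; split => //; exact: K0z.1.
  (* The empty family is treated apart because KKM needs at least one point. *)
  move=> s sD; have [s0|s0] := posnP (size (enum_fset s)).
    exists k => y ys; have : y \in enum_fset s by [].
    by rewrite (size0nil s0).
  pose y (i : 'I_(size (enum_fset s))) := (enum_fset s)`_i.
  have yP i : D (y i) /\ K0 (y i).
    have yis : y i \in enum_fset s by exact: mem_nth.
    exact/set_mem/sD.
  have [x K0x xy] := KKM_equilibrium C_convex C_pointed K0c (@subIsetl _ _ _)
    f_usc_l f_convex f_diag s0 yP.
  exists x => z zs; split => //.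
  have zs' : z \in enum_fset s by [].
  have := xy (Ordinal (etrans (index_mem z _) zs')).
  by rewrite /y /= nth_index.
have ball_nbhs y : `|y| < M -> nbhs y [set z : X | `|z| < M].
  move=> yM; apply: (@norm_continuous _ _ y [set t : R | t < M]).
  by apply: open_nbhs_nbhs; split; [exact: open_lt|].
have D_dense_norm := self_segment_dense_norm D_dense.
(* Membership in [K0] comes from one set [G d], so [D] must have a point [d] in the ball; density
   near [k] provides it. *)
have [Kx0 x0M] : K0 x0.
  have [d [Dd /= dM]] := D_dense_norm k Kk _ (ball_nbhs k kM).
  by have [] : G d x0 by apply: x0G; split => //; split; [exact: D_sub_K|exact: ltW].
have inner y : K y -> `|y| < M -> ~ strictly_negative C (f x0 y).
  move=> Ky yM.
  have [Dy|nDy] := pselect (D y).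
    by have [] : G y x0 by apply: x0G; split => //; split => //; exact: ltW.
  move=> neg.
  have [U yU UK] := strictly_negative_open (f_usc_r _ Kx0 _ (conj Ky nDy)) neg.
  have [z [Dz [Uz zM]]] : D `&` (U `&` [set z | `|z| < M]) !=set0.
    apply: (D_dense_norm y Ky); apply: filterI; last exact: ball_nbhs.
    exact: nbhs_weak_norm.
  have Kz := D_sub_K _ Dz.
  have [_] : G z x0 by apply: x0G; split => //; split => //; exact: ltW.
  by apply; exact: UK.
(* Take [x0] itself if its norm is at most [r]. Otherwise coercivity gives a value in [-C], which
   [inner] forces to be 0. *)
have [y0 [Ky0 y0M fy0]] : exists y0, [/\ K y0, `|y0| < M & f x0 y0 = 0].
  have [x0r|x0r] := leP `|x0| r.
    by exists x0; split; rewrite ?f_diag// (le_lt_trans x0r).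
  have [y0 [Ky0 y0x0 fC]] := coer _ Kx0 x0r.
  have y0M : `|y0| < M by exact: lt_le_trans x0M.
  exists y0; split => //; apply: contrapT => f0.
  by apply: (inner y0) => //; split.
exists x0 => // y Ky neg.
have [t [t0 t1 tM]] : exists t, [/\ 0 < t, t <= 1 &
    `|t *: y + (1 - t) *: y0| < M].
  have d0 : 0 < M - `|y0| by rewrite subr_gt0.
  have n0 : 0 < `|y - y0| + (M - `|y0|) by rewrite ltr_wpDl.
  (* Chosen so that [t <= 1] and the displacement [t * |y - y0|] stays below the margin
     [M - |y0|]. *)
  exists ((M - `|y0|) / (`|y - y0| + (M - `|y0|))).
  split; first exact: divr_gt0.
    by rewrite ler_pdivrMr// mul1r lerDr.
  set t := _ / _; have t0 : 0 < t by exact: divr_gt0.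
  rewrite scalerBl scale1r addrCA -scalerBr.
  apply: le_lt_trans (ler_normD _ _) _; rewrite -ltrBrDl normrZ gtr0_norm//.
  by rewrite /t mulrAC ltr_pdivrMr// ltr_pM2l// ltrDl.
have Kt : K (t *: y + (1 - t) *: y0).
  by have /convex_setP Kc := K_convex; apply: Kc => //; exact: ltW.
apply: (inner _ Kt tM).
have := cone_convex_on2 K_convex (f_convex _ Kx0) Ky Ky0 (ltW t0) t1.
rewrite fy0 scaler0 addr0 => /(strictly_negative_le C_convex C_pointed); apply.
exact: strictly_negativeZ.
Qed.
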